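(* Let $\Bbbk$ be a field and let $\sim$ be a word relation. Then the subspecies $\mathscr K^{(\sim)}$ of $\mathscr W$ is a sub-coalgebroid of the species coalgebroid $(\mathscr W,\nabla_{\mathrm{sh}},\iota_{\mathrm{sh}},\Delta_\odot,\epsilon_\odot)$ if and only if $\sim$ is algebraic.
   Context: Words. $\mathbb N=\{0,1,2,\dots\}$, $[n]=\{1,\dots,n\}$. A word is a finite sequence of positive integers; $\emptyset$ is the empty word, $\ell(w)$ the length, $\max(w)$ the largest letter, $\max(\emptyset)=0$. $w\uparrow m$, $w\downarrow m$: add, respectively subtract, $m$ to/from every letter. $w\cap S$: subword formed by omitting letters not in $S$. For words $u,v$ of lengths $m,n$, $u\sqcup\!\sqcup v$ is the sum, over $I\subset[m+n]$ with $|I|=m$, of the unique word of length $m+n$ whose restriction to positions in $I$ is $u$ and to the other positions is $v$. Word relations. A word relation is an equivalence relation $\sim$ on words such that $v\sim w$ only if $v,w$ have the same set of letters (multiplicities may differ). It is algebraic if for all words $v,w$: (a) if $v\sim v'$ and $w\sim w'$ then $vw\sim v'w'$ (concatenation); (b) if $v\sim w$ and $I=\{m+1,\dots,n\}$ with $m,n\in\mathbb N$, then $(v\cap I)\downarrow m\sim(w\cap I)\downarrow m$. Linearly compact spaces. A linearly compact $\Bbbk$-vector space is a topological vector space $V=\prod_{i}\Bbbk v_i$ with the product topology, each $\Bbbk v_i$ discrete; $\{v_i\}$ is a pseudobasis. Morphisms are continuous linear maps. $V\hat\otimes W$ is the linearly compact space with pseudobasis $\{v_i\otimes w_j\}$ for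 pseudobases $\{v_i\},\{w_j\}$ of $V,W$. This is a symmetric monoidal category with unit $\Bbbk$ and braiding $x\otimes y\mapsto y\otimes x$; linearly compact coalgebras are its comonoids. Species coalgebroids. A linearly compact coalgebra species is a functor $\mathscr V$ from finite sets with bijections to linearly compact coalgebras; write $\Delta_S,\epsilon_S$ for the coproduct and counit of $\mathscr V[S]$. A species coalgebroid is such a $\mathscr V$ together with morphisms of linearly compact coalgebras $\nabla_{ST}:\mathscr V[S]\hat\otimes\mathscr V[T]\to\mathscr V[S\sqcup T]$ for all disjoint finite sets $S,T$, natural with respect to bijections, and $\iota_\varnothing:\Bbbk\to\mathscr V[\varnothing]$, satisfying associativity $\nabla_{S\sqcup T,U}(\nabla_{ST}\hat\otimes\mathrm{id})=\nabla_{S,T\sqcup U}(\mathrm{id}\hat\otimes\nabla_{TU})$ and unitality $\nabla_{\varnothing S}(\iota_\varnothing(1)\otimes x)=x=\nabla_{S\varnothing}(x\otimes\iota_\varnothing(1))$. A subspecies $\mathscr H\subset\mathscr V$ consists of linearly compact subspaces $\mathscr H[S]\subset\mathscr V[S]$ with $\mathscr V[\sigma](\mathscr H[S])\subset\mathscr H[T]$ for all bijections $\sigma:S\to T$. It is a sub-coalgebroid if $\Delta_S(\mathscr H[S])\subset\mathscr H[S]\hat\otimes\mathscr H[S]$, $\nabla_{ST}(\mathscr H[S]\hat\otimes\mathscr H[T])\subset\mathscr H[S\sqcup T]$ and $\iota_\varnothing(1)\in\mathscr H[\varnothing]$ for all disjoint finite sets $S,T$. The species $\mathscr W$. For a finite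 set $S$ of size $n$, $\mathscr W[S]$ is the direct sum, over the $n!$ bijections $\lambda:[n]\to S$, of the linearly compact spaces $\widehat{\mathbf W}_\lambda$ with pseudobasis the symbols $[w,\lambda]$, $w$ a word with $\max(w)\le n$. For a bijection $\sigma:S\to T$, $\mathscr W[\sigma]([w,\lambda])=[w,\sigma\circ\lambda]$. The coproduct and counit are the continuous linear maps with $\Delta_\odot([w,\lambda])=\sum_{i=0}^{\ell(w)}[w_1\cdots w_i,\lambda]\otimes[w_{i+1}\cdots w_{\ell(w)},\lambda]$, $\epsilon_\odot([w,\lambda])=1$ if $w=\emptyset$ and $0$ otherwise. For disjoint $S,T$ and bijections $\lambda:[m]\to S$, $\mu:[n]\to T$, let $\lambda\oplus\mu:[m+n]\to S\sqcup T$ be $i\mapsto\lambda(i)$ for $i\in[m]$, $m+j\mapsto\mu(j)$ for $j\in[n]$; the product is the continuous linear map with $\nabla_{\mathrm{sh}}([v,\lambda]\otimes[w,\mu])=[v\sqcup\!\sqcup(w\uparrow m),\lambda\oplus\mu]$ (where $[\cdot,\lambda\oplus\mu]$ is extended linearly), and $\iota_{\mathrm{sh}}(1)=[\emptyset,\mathrm{id}_\varnothing]$. These data form a species coalgebroid. The subspecies $\mathscr K^{(\sim)}$. For a finite set $S$ of size $n$, a bijection $\lambda:[n]\to S$ and a $\sim$-equivalence class $E$ of words with letters in $[n]$, let $\kappa_E^\lambda=\sum_{w\in E}[w,\lambda]\in\widehat{\mathbf W}_\lambda\subset\mathscr W[S]$. $\mathscr K^{(\sim)}[S]\subset\mathscr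 W[S]$ is the linearly compact subspace with pseudobasis the set of all such $\kappa_E^\lambda$. *)

(* Defs.v *)
From Stdlib Require Import RelationClasses.
From HB Require Import structures.
From mathcomp Require Import all_boot all_order all_algebra.
From mathcomp Require Import finmap all_classical.
From mathcomp Require Import topology function_spaces.

Set Implicit Arguments.
Unset Strict Implicit.
Unset Printing Implicit Defensive.

Import GRing.Theory.
Local Open Scope classical_set_scope.
Local Open Scope ring_scope.

(** * Words *)

Definition word : choiceType := {s : seq nat | 0%N \notin s}.

Definition letters (w : word) : seq nat := val w.

Definition wmax (w : word) : nat := (\max_(a <- letters w) a)%N.

Fact wcat_subproof (v w : word) : 0%N \notin letters v ++ letters w.
Proof. by rewrite mem_cat negb_or (valP v) (valP w). Qed.

Definition wcat (v w : word) : word := exist (fun s => 0%N \notin s) _ (wcat_subproof v w).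

Fact wcapdown_subproof (m n : nat) (w : word) :
  0%N \notin [seq (a - m)%N | a <- letters w & (m < a <= n)%N].
Proof.
apply/negP => /mapP[a]; rewrite mem_filter => /andP[/andP[lt_ma _] _] /esym.
by move/eqP; rewrite subn_eq0 leqNgt lt_ma.
Qed.

(** [wcapdown m n w] is (w ∩ {m+1, ..., n}) ↓ m. *)
Definition wcapdown (m n : nat) (w : word) : word :=
  exist (fun s => 0%N \notin s) _ (wcapdown_subproof m n w).

Definition word_relation (R : word -> word -> Prop) : Prop :=
  Equivalence R /\ forall v w, R v w -> letters v =i letters w.

Definition algebraic (R : word -> word -> Prop) : Prop :=
  (forall v v' w w', R v v' -> R w w' -> R (wcat v w) (wcat v' w')) /\
  (forall v w m n, R v w -> R (wcapdown m n v) (wcapdown m n w)).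

(** * Linearly compact vector spaces *)

(** Every linearly compact space is given with a pseudobasis indexed by [I]:
    it is the product of copies of the discrete field [k] over [I]. *)
Definition lc (k : fieldType) (I : Type) : Type := I -> k.

HB.instance Definition _ (k : fieldType) (I : Type) :=
  GRing.Lmodule.copy (lc k I) (I -> k^o).
HB.instance Definition _ (k : fieldType) (I : Type) :=
  Topological.copy (lc k I) {ptws I -> discrete_topology k}.

Record lcmap (k : fieldType) (I J : Type) := LcMap {
  lcmap_fun :> lc k I -> lc k J;
  lcmap_linear : linear lcmap_fun;
  lcmap_continuous : continuous lcmap_fun }.

Section LinearlyCompact.
Variable k : fieldType.
Implicit Types I J : choiceType.

Definition lc_basis I (i : I) : lc k I := fun j => (j == i)%:R.

(** The sum of a possibly infinite family, taken coordinatewise: the limit of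
    the finite partial sums in the product topology when every coordinate is
    nonzero for finitely many members only. *)
Definition lc_sum (X : choiceType) I (A : set X) (b : X -> lc k I) : lc k I :=
  fun i => \sum_(x \in A) b x i.

Definition summable I J (b : I -> lc k J) : Prop :=
  forall j, finite_set [set i | b i j != 0].

(** The map sending [lc_basis i] to [b i], for summable [b]. *)
Definition lc_ext_fun I J (b : I -> lc k J) (x : lc k I) : lc k J :=
  lc_sum setT (fun i => x i *: b i).

Lemma lc_ext_funE I J (b : I -> lc k J) (sb : summable b) x j :
  lc_ext_fun b x j =
  \sum_(i <- fset_set [set i | b i j != 0]) x i * b i j.
Proof.
rewrite /lc_ext_fun /lc_sum (fsbigTE (fset_set [set i | b i j != 0])) //.
move=> i; rewrite in_fset_set; last exact: sb.
rewrite notin_setE /= => /negP; rewrite negbK => /eqP b0.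
by rewrite /= [LHS](_ : _ = x i * b i j) // b0 mulr0.
Qed.

Lemma lc_ext_linear I J (b : I -> lc k J) :
  summable b -> linear (lc_ext_fun b).
Proof.
move=> sb a x y; apply/funext => j.
rewrite [RHS](_ : _ = a * lc_ext_fun b x j + lc_ext_fun b y j) //.
rewrite !lc_ext_funE// mulr_sumr -big_split; apply: eq_bigr => i _ /=.
by rewrite mulrA -mulrDl.
Qed.

Lemma nbhs_coord I (x : lc k I) (i : I) : nbhs x [set y | y i = x i].
Proof.
have := @proj_continuous I (fun _ => discrete_topology k) i x [set x i].
by apply; exact: (@discrete_set1 (discrete_topology k)).
Qed.

Lemma lc_ext_continuous I J (b : I -> lc k J) :
  summable b -> continuous (lc_ext_fun b).
Proof.
move=> sb x; apply/cvg_sup; first exact/fmap_filter/nbhs_filter.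
move=> j U [V] [[W] oW <-] Wx WU.
suff : nbhs x [set y : lc k I | forall i, b i j != 0 -> y i = x i].
  apply: filterS => y yx; apply: WU; rewrite /= in Wx *.
  suff -> : lc_ext_fun b y j = lc_ext_fun b x j by [].
  rewrite !lc_ext_funE// big_seq [RHS]big_seq; apply: eq_bigr => i.
  by rewrite in_fset_set ?inE; [move=> /yx -> | exact: sb].
have := @filter_bigI _ _ (fset_set [set i | b i j != 0])
  (fun i => [set y : lc k I | y i = x i]) (nbhs x)
  (nbhs_filter x) (fun i _ => nbhs_coord x i).
by rewrite fset_setK; [apply: filterS => y h i bi; exact: (h i bi) | exact: sb].
Qed.

Definition lc_ext I J (b : I -> lc k J) (sb : summable b) : lcmap k I J :=
  LcMap (lc_ext_linear sb) (lc_ext_continuous sb).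

Lemma lc_ext_basis I J (b : I -> lc k J) (sb : summable b) i :
  lc_ext sb (lc_basis i) = b i.
Proof.
apply/funext => j; rewrite /= lc_ext_funE//.
have fA : finite_set [set i | b i j != 0] by exact: sb.
rewrite [LHS](eq_bigr (fun i0 => if i0 == i then b i j else 0)); last first.
  by move=> i0 _; rewrite /lc_basis; case: eqP => [->|_]; rewrite ?mul1r ?mul0r.
have [b0|bn0] := eqVneq (b i j) 0.
  by rewrite big1 ?b0 // => i0 _; case: ifP.
rewrite (bigD1_seq i) ?fset_uniq ?in_fset_set ?inE//= eqxx.
by rewrite big1 ?addr0// => i0 /negPf ->.
Qed.

Definition lc_subspace I (H : set (lc k I)) : Prop :=
  [/\ closed H, H 0 & forall (a : k) x y, H x -> H y -> H (a *: x + y)].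

(** The smallest linearly compact (that is, closed) subspace containing [B];
    when [B] is a pseudobasis of a linearly compact subspace, it is that
    subspace. *)
Definition lc_span I (B : set (lc k I)) : set (lc k I) := smallest (@lc_subspace I) B.

Definition lc_tensor I J (x : lc k I) (y : lc k J) : lc k (I * J) :=
  fun p => x p.1 * y p.2.

(** The completed tensor product of two subspaces, inside the completed tensor
    product of the ambient spaces.  If [h] and [h'] are pseudobases of [H] and
    [H'], the tensors of their members form a pseudobasis of it. *)
Definition lc_tensor_sub I J (H : set (lc k I)) (H' : set (lc k J)) :
    set (lc k (I * J)) :=
  lc_span [set lc_tensor x y | x in H & y in H'].

End LinearlyCompact.

(** * Species *)

Definition bij (S T : finType) : finType :=
  {f : {ffun S -> T} | `[< bijective f >]}.

Definition bij_fun (S T : finType) (f : bij S T) : S -> T := val f.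

Fact mkbij_subproof (S T : finType) (f : S -> T) :
  bijective f -> `[< bijective (finfun f) >].
Proof.
case=> g fK gK; apply/asboolP.
by exists g => x; rewrite ?ffunE ?fK ?gK.
Qed.

Definition mkbij (S T : finType) (f : S -> T) (bf : bijective f) : bij S T :=
  exist (fun f : {ffun S -> T} => `[< bijective f >]) _ (mkbij_subproof bf).

(** The structure maps of a species coalgebroid, disjoint unions being sum
    types; [cb_pb S] indexes a pseudobasis of the value at [S].  Being a
    sub-coalgebroid only refers to these maps, so their axioms are left out. *)
Record coalgebroid_data (k : fieldType) := CoalgebroidData {
  cb_pb : finType -> choiceType;
  cb_act (S T : finType) : bij S T -> lcmap k (cb_pb S) (cb_pb T);
  cb_coprod (S : finType) : lcmap k (cb_pb S) (cb_pb S * cb_pb S);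
  cb_counit (S : finType) : lcmap k (cb_pb S) unit;
  cb_prod (S T : finType) : lcmap k (cb_pb S * cb_pb T) (cb_pb (S + T)%type);
  cb_unit : lcmap k unit (cb_pb void) }.

Definition subsets (k : fieldType) (V : coalgebroid_data k) : Type :=
  forall S : finType, set (lc k (cb_pb V S)).


Definition subspecies (k : fieldType) (V : coalgebroid_data k) (H : subsets V) :
    Prop :=
  (forall S, lc_subspace (H S)) /\
  (forall S T (s : bij S T), cb_act V s @` H S `<=` H T).

Definition sub_coalgebroid (k : fieldType) (V : coalgebroid_data k) (H : subsets V) :
    Prop :=
  [/\ subspecies H,
      forall S, cb_coprod V S @` H S `<=` lc_tensor_sub (H S) (H S),
      forall S T, cb_prod V S T @` lc_tensor_sub (H S) (H T) `<=` H (S + T)%type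
    & H void (cb_unit V (cst 1))].

Arguments sub_coalgebroid {k} V H.

(** * The species W *)

Definition word_le (n : nat) : choiceType := {w : word | (wmax w <= n)%N}.

Definition W_pb (S : finType) : choiceType := (bij 'I_#|S| S * word_le #|S|)%type.

Definition W_word (S : finType) (p : W_pb S) : seq nat := letters (val p.2).

(** The symbol [w, l]; it is 0 if [w] is not a word with letters in
    {1, ..., #|S|}, which does not happen in the uses below. *)
Definition W_gen (k : fieldType) (S : finType) (w : seq nat) (l : bij 'I_#|S| S) :
    lc k (W_pb S) :=
  fun p => ((W_word p == w) && (p.1 == l))%:R.

Fact card_bij (S T : finType) : bij S T -> #|T| = #|S|.
Proof. by move=> s; symmetry; apply: bij_eq_card; exact/asboolP/(valP s). Qed.

Fact bij_act_subproof (S T : finType) (s : bij S T) (l : bij 'I_#|S| S) :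
  bijective (fun i => bij_fun s (bij_fun l (cast_ord (card_bij s) i))).
Proof.
have bc : bijective (cast_ord (card_bij s)).
  by exists (cast_ord (esym (card_bij s))); [exact: cast_ordK|exact: cast_ordKV].
have bs : bijective (bij_fun s) by exact/asboolP/(valP s).
have bl : bijective (bij_fun l) by exact/asboolP/(valP l).
exact: bij_comp bs (bij_comp bl bc).
Qed.

Definition bij_act (S T : finType) (s : bij S T) (l : bij 'I_#|S| S) :
    bij 'I_#|T| T :=
  mkbij (bij_act_subproof s l).

(** Letters of words start at 1, whereas the source of a bijection onto [S] is
    indexed from 0. *)
Definition oplus_fun (S T : finType) (l : bij 'I_#|S| S) (m : bij 'I_#|T| T)
    (i : 'I_#|{: S + T}|) : S + T :=
  match fintype.split (cast_ord (card_sum S T) i) with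
  | inl a => inl (bij_fun l a)
  | inr b => inr (bij_fun m b)
  end.

Fact oplus_subproof (S T : finType) (l : bij 'I_#|S| S) (m : bij 'I_#|T| T) :
  bijective (oplus_fun l m).
Proof.
have [l' lK l'K] : bijective (bij_fun l) by exact/asboolP/(valP l).
have [m' mK m'K] : bijective (bij_fun m) by exact/asboolP/(valP m).
exists (fun x : S + T => cast_ord (esym (card_sum S T))
  (fintype.unsplit match x with inl a => inl (l' a) | inr b => inr (m' b) end)).
  move=> i; rewrite /oplus_fun -[RHS](cast_ordK (card_sum S T)).
  congr cast_ord; rewrite -[RHS]splitK.
  by case: (fintype.split _) => a; rewrite ?lK ?mK.
move=> x; rewrite /oplus_fun cast_ordKV unsplitK.
by case: x => a; rewrite ?l'K ?m'K.
Qed.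

Definition oplus (S T : finType) (l : bij 'I_#|S| S) (m : bij 'I_#|T| T) :
    bij 'I_#|{: S + T}| (S + T)%type :=
  mkbij (oplus_subproof l m).

Definition enum_bij (S : finType) : bij 'I_#|S| S := mkbij (@enum_val_bij S).

(** The subword of [z] at the positions in [I]. *)
Definition subword (N : nat) (I : {set 'I_N}) (z : seq nat) : seq nat :=
  [seq nth 0%N z i | i : 'I_N <- enum I].

(** [z] is the word of length [N] whose restriction to the positions in [I] is
    [u] and whose restriction to the other positions is [v]. *)
Definition is_shuffle (N : nat) (I : {set 'I_N}) (u v z : seq nat) : bool :=
  [&& size z == N, subword I z == u & subword (~: I) z == v].

Section SpeciesW.
Variable k : fieldType.

(** The values of the structure maps on the pseudobases. *)
Definition W_act_gen (S T : finType) (s : bij S T) (p : W_pb S) : lc k (W_pb T) :=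
  W_gen k (W_word p) (bij_act s p.1).

Definition W_coprod_gen (S : finType) (p : W_pb S) : lc k (W_pb S * W_pb S) :=
  \sum_(i < (size (W_word p)).+1)
    lc_tensor (W_gen k (take i (W_word p)) p.1) (W_gen k (drop i (W_word p)) p.1).

Definition W_counit_gen (S : finType) (p : W_pb S) : lc k unit :=
  fun=> (W_word p == [::])%:R.

Definition W_prod_gen (S T : finType) (pq : W_pb S * W_pb T) :
    lc k (W_pb (S + T)%type) :=
  let v := W_word pq.1 in
  let w := [seq (a + #|S|)%N | a <- W_word pq.2] in
  fun r => \sum_(I : {set 'I_(size v + size w)} | #|I| == size v)
    (is_shuffle I v w (W_word r) && (r.1 == oplus pq.1.1 pq.2.1))%:R.

Definition W_unit_gen (_ : unit) : lc k (W_pb void) := W_gen k [::] (enum_bij void).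

Lemma W_word_inj S : injective (fun p : W_pb S => (p.1, W_word p)).
Proof.
move=> [l w] [l' w'] [/= -> ww']; congr pair.
by do 2 apply: val_inj.
Qed.

Lemma finite_W_pb S (A : set (seq nat)) :
  finite_set A -> finite_set [set p : W_pb S | A (W_word p)].
Proof.
move=> fA.
have fB : finite_set ([set: bij 'I_#|S| S] `*` A).
  by apply: finite_setX => //; exact: finite_finset.
have fi : {in (fun p : W_pb S => (p.1, W_word p)) @^-1`
    ([set: bij 'I_#|S| S] `*` A) &, injective (fun p : W_pb S => (p.1, W_word p))}.
  by move=> p q _ _; exact: W_word_inj.
by apply: (sub_finite_set _ (finite_preimage fi fB)) => p.
Qed.

Lemma finite_bounded_words (N n : nat) :
  finite_set [set s : seq nat | (size s <= N)%N /\ {in s, forall a, (a <= n)%N}].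
Proof.
apply: (@sub_finite_set _ _
  ((fun t : N.-bseq 'I_n.+1 => map val t) @` setT)); last first.
  by apply: finite_image; exact: finite_finset.
move=> s [sN sn].
have sN' : (size [seq (inord a : 'I_n.+1) | a <- s] <= N)%N by rewrite size_map.
exists (Bseq sN') => //=; rewrite -map_comp -[RHS]map_id.
by apply/eq_in_map => a /sn an /=; rewrite inordK.
Qed.

Lemma W_act_summable S T (s : bij S T) : summable (W_act_gen s).
Proof.
move=> q; have := finite_W_pb S (finite_set1 (W_word q)); apply: sub_finite_set.
move=> p /=; rewrite /W_act_gen /W_gen.
by case: (W_word q =P _) => [-> //|_]; rewrite mulr0n eqxx.
Qed.

Lemma W_coprod_summable S : summable (@W_coprod_gen S).
Proof.
move=> q; have := finite_W_pb S (finite_set1 (W_word q.1 ++ W_word q.2)).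
apply: sub_finite_set.
move=> p /=; apply: contra_neqP => pq.
rewrite /W_coprod_gen fct_sumE big1// => i _.
rewrite /lc_tensor /W_gen; case: (W_word q.1 =P _) => [q1|_]; last by rewrite mul0r.
case: (W_word q.2 =P _) => [q2|_]; last by rewrite mulr0.
by case: pq; rewrite q1 q2 cat_take_drop.
Qed.

Lemma W_counit_summable S : summable (@W_counit_gen S).
Proof.
move=> q; have := finite_W_pb S (finite_set1 [::]); apply: sub_finite_set.
by move=> p /=; rewrite /W_counit_gen; case: (W_word p =P _) => [-> //|_]; rewrite mulr0n eqxx.
Qed.

Lemma W_prod_summable S T : summable (@W_prod_gen S T).
Proof.
move=> r; set N := size (W_word r); set n := (\max_(a <- W_word r) a)%N.
have fA := @finite_bounded_words N n.
have := finite_setX (finite_W_pb S fA) (finite_W_pb T fA).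
apply: sub_finite_set.
move=> pq /=; rewrite /W_prod_gen /=.
set v := W_word pq.1; set w := map _ _ => pq0.
have [I] : exists I : {set 'I_(size v + size w)}, is_shuffle I v w (W_word r).
  apply: contrapT => noI; move: pq0; rewrite big1 ?eqxx// => I _.
  by case: (boolP (is_shuffle _ _ _ _)) => // sI; case: noI; exists I.
case/and3P => /eqP sz /eqP vE /eqP wE.
have le_sub (J : {set 'I_(size v + size w)}) :
    {in subword J (W_word r), forall a, (a <= n)%N}.
  move=> a /mapP[i _ ->]; rewrite /n; apply: leq_bigmax_seq => //.
  by rewrite mem_nth// sz.
split; split.
- by rewrite /N sz leq_addr.
- by rewrite -/v -vE; exact: le_sub.
- by rewrite /N sz /w size_map leq_addl.
- move=> a aw; apply: (@leq_trans (a + #|S|)); first exact: leq_addr.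
  by apply: (le_sub (~: I)); rewrite wE; exact: map_f.
Qed.

Lemma W_unit_summable : summable W_unit_gen.
Proof. by move=> r; exact: finite_finset. Qed.

Definition W : coalgebroid_data k := {|
  cb_act S T s := lc_ext (W_act_summable s);
  cb_coprod S := lc_ext (@W_coprod_summable S);
  cb_counit S := lc_ext (@W_counit_summable S);
  cb_prod S T := lc_ext (@W_prod_summable S T);
  cb_unit := lc_ext W_unit_summable |}.

(** * The subspecies K *)

(** For a word relation, all words equivalent to [v] have the letters of [v], so
    these are the classes of words with letters in {1, ..., n}. *)
Definition is_class (R : word -> word -> Prop) (n : nat) (E : set word) : Prop :=
  exists2 v, (wmax v <= n)%N & E = [set w | R v w].

Definition kappa (S : finType) (E : set word) (l : bij 'I_#|S| S) : lc k (W_pb S) :=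
  lc_sum E (fun w => W_gen k (letters w) l).

Definition K (R : word -> word -> Prop) : subsets W :=
  fun S => lc_span [set x : lc k (W_pb S) |
    exists2 E, is_class R #|S| E & exists l, x = kappa E l].

End SpeciesW.

Arguments K k R S : clear implicits.

(* Main.v *)
From Stdlib Require Import RelationClasses.
From mathcomp Require Import all_boot all_algebra.
From mathcomp Require Import finmap all_classical.
From mathcomp Require Import topology function_spaces.
Require Import Defs.

(** Everything reduces to functions that are constant on equivalence classes.

    An element of W[S] is an arbitrary function of the symbols [w, λ], and κ_E^λ
    is the indicator function of the class of the symbols [w, λ] with w in E.
    The closed span of the indicator functions of all classes of an equivalence
    relation is the space of all functions constant on the classes
    ([lc_span_invariant]), because a linear combination of finitely many
    indicators can match such a function at any finitely many points.  The same
    holds for the product relation on pairs of symbols.  So both K[S] and the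
    completed tensor product of K[S] and K[T] are spaces of invariant functions
    ([K_invariant], [K_tensor]).

    The structure maps of W are pullbacks along partial functions going the
    other way:
    - for x in W[S], the coefficient of Δ(x) at ([u, λ], [v, μ]) is x [uv, λ]
      if λ = μ and 0 otherwise;
    - for |S| = m, |T| = n and x in the completed tensor product of W[S] and
      W[T], the coefficient of ∇(x) at [z, λ ⊕ μ] is the coefficient of x at the
      pair of [z ∩ {1, ..., m}, λ] and [(z ∩ {m+1, ..., m+n}) ↓ m, μ].  The
      reason is that in a shuffle of v and w ↑ m the letters at most m are those
      of v, so that z determines v, w and the positions of v, and no
      multiplicities arise ([sum_shuffle]).

    A pullback sends all invariant functions to invariant ones exactly when the
    partial function respects the relations; necessity is seen on the indicator
    function of one class.  For the coproduct this says that ∼ is compatible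
    with concatenation ([K_coprod_stable]), and for the product that ∼ is
    compatible with restriction to {1, ..., m} and to {m+1, ..., m+n} whenever
    all letters are at most m+n; a general interval is reached by cutting off
    from below and then from above ([K_prod_stable]).  The action of bijections
    changes λ only, and all words with letters in the empty set are empty, so
    the other conditions are automatic. *)

Set Implicit Arguments.
Unset Strict Implicit.
Unset Printing Implicit Defensive.

Import GRing.Theory.

(** * Shuffles of words with separated letters *)

Section Shuffles.
Local Open Scope nat_scope.

Lemma subword_filter (N : nat) (P : pred nat) (z : seq nat) : size z = N ->
  subword [set i : 'I_N | P (nth 0 z i)] z = seq.filter P z.
Proof.
move=> zN; rewrite /subword -[in RHS](mkseq_nth 0 z) /mkseq zN -val_enum_ord.
rewrite -map_comp filter_map; congr map.
rewrite {1}/enum_mem -enumT; apply: eq_filter => i /=.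
by rewrite inE.
Qed.

(** If the letters of one factor of a shuffle satisfy [P] and those of the other
    do not, then the positions of the first factor can be read off. *)
Lemma subword_setP (N : nat) (P : pred nat) (A : {set 'I_N}) (z : seq nat) :
  all P (subword A z) -> all (predC P) (subword (~: A) z) ->
  A = [set i : 'I_N | P (nth 0 z i)].
Proof.
move=> /allP PA /allP PA'; apply/setP => i; rewrite inE.
have [iA|iA] := boolP (i \in A).
  by symmetry; apply/PA/mapP; exists i; rewrite ?mem_enum.
apply/esym/negbTE/PA'/mapP; exists i => //.
by rewrite mem_enum inE.
Qed.

(** A word arises at most once as a shuffle of [v] and [w] when [P] separates
    their letters; hence the coefficient is 0 or 1 also in positive
    characteristic. *)
Lemma sum_shuffle (k : fieldType) (P : pred nat) (v w z : seq nat) :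
  all P v -> all (predC P) w ->
  (\sum_(A : {set 'I_(size v + size w)} | #|A| == size v)
     (is_shuffle A v w z)%:R =
   ((v == seq.filter P z) && (w == seq.filter (predC P) z))%:R :> k)%R.
Proof.
move=> Pv Pw.
pose A0 := [set i : 'I_(size v + size w) | P (nth 0 z i)].
have A0C : ~: A0 = [set i : 'I_(size v + size w) | predC P (nth 0 z i)].
  by apply/setP => i; rewrite !inE.
have shA0 A : is_shuffle A v w z -> A = A0.
  case/and3P => _ /eqP vE /eqP wE; apply: subword_setP; first by rewrite vE.
  by rewrite wE.
have [/andP[/eqP vE /eqP wE]|vw] := boolP (_ && _); last first.
  rewrite big1 // => A _; case: (boolP (is_shuffle A v w z)) => // sh.
  case/negP: vw; move: (sh); rewrite (shA0 _ sh) => /and3P[/eqP zN].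
  by rewrite A0C !subword_filter // => /eqP -> /eqP ->; rewrite !eqxx.
have zN : size z = size v + size w by rewrite vE wE !size_filter count_predC.
have vA0 : subword A0 z = v by rewrite subword_filter.
have sh0 : is_shuffle A0 v w z.
  by rewrite /is_shuffle zN vA0 A0C subword_filter // -wE !eqxx.
rewrite (bigD1 A0) /=; last by rewrite -[in X in _ == X]vA0 size_map -cardE.
rewrite sh0 big1 ?addr0 // => A /andP[_ nA0].
by case: (boolP (is_shuffle A v w z)) => // /shA0 AA0; rewrite AA0 eqxx in nA0.
Qed.

End Shuffles.

(** * Largest letters and intervals of letters *)

Section Words.
Local Open Scope nat_scope.

Lemma wmax_leP (w : word) n : reflect {in letters w, forall a, a <= n} (wmax w <= n).
Proof.
apply: (iffP (bigmax_leqP_seq _ _ _ _)) => h a; first by move=> aw; exact: h.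
by move=> aw _; exact: h.
Qed.

Lemma letters_gt0 (w : word) a : a \in letters w -> 0 < a.
Proof. by case: a => // w0; have := valP w; rewrite /letters in w0; rewrite w0. Qed.

Lemma wmax_rel R v w : word_relation R -> R v w -> wmax v = wmax w.
Proof. by move=> [_ RL] /RL vw; apply: eq_big_idem => //; exact: maxnn. Qed.

Lemma wmax_wcat v w n : wmax v <= n -> wmax w <= n -> wmax (wcat v w) <= n.
Proof.
move=> /wmax_leP vn /wmax_leP wn; apply/wmax_leP => a.
by rewrite mem_cat => /orP[/vn|/wn].
Qed.

Lemma wmax_wcapdown m n w : wmax (wcapdown m n w) <= n - m.
Proof.
apply/wmax_leP => a /mapP[c]; rewrite mem_filter => /andP[/andP[_ cn] _] ->.
exact: leq_sub2r.
Qed.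

Lemma letters_wcapdown0 n w :
  letters (wcapdown 0 n w) = [seq a <- letters w | a <= n].
Proof.
rewrite {1}/letters /= (eq_map subn0) map_id.
by apply: eq_in_filter => a /letters_gt0 ->.
Qed.

(** Undoing the shift turns the second factor of the product into a plain
    subword, the form in which shuffles are recognized by [sum_shuffle]. *)
Lemma wcapdown_up m n w : wmax w <= m + n ->
  [seq a + m | a <- letters (wcapdown m (m + n) w)] =
  [seq a <- letters w | ~~ (a <= m)].
Proof.
move=> /wmax_leP wn; rewrite {1}/letters /= -map_comp -[RHS]map_id.
rewrite (@eq_in_filter _ (fun a => m < a <= m + n) (fun a => ~~ (a <= m))).
  by apply/eq_in_map => a; rewrite mem_filter -ltnNge => /andP[ma _] /=;
    rewrite subnK // ltnW.
by move=> a /wn an; rewrite an andbT ltnNge.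
Qed.

(** With [t] at least the largest letter, this obtains a general interval from
    the two kinds of intervals that the product of W sees: final ones and
    initial ones. *)
Lemma wcapdown_wcapdown m n t w : n <= t ->
  wcapdown m n w = wcapdown 0 (n - m) (wcapdown m t w).
Proof.
move=> nt; apply: val_inj; rewrite /= (eq_map subn0) map_id filter_map.
congr map; rewrite -filter_predI; apply: eq_filter => a /=.
rewrite subn_gt0; case: (ltnP m a) => //= ma.
have [an|na] := leqP a n; first by rewrite leq_sub2r // (leq_trans an nt).
rewrite leq_subLR; symmetry; apply/negbTE; rewrite negb_and -ltnNge.
by rewrite -maxnE gtn_max ma na.
Qed.

End Words.

Local Open Scope classical_set_scope.
Local Open Scope ring_scope.

(** * Functions constant on equivalence classes *)

Section InvariantFunctions.
Variables (k : fieldType) (I : choiceType).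
Implicit Types (r : I -> I -> Prop) (x y : lc k I).

Definition invariant r : set (lc k I) :=
  [set x | forall i j, r i j -> x i = x j].

Definition class_ind r (i : I) : lc k I := fun j => (`[< r i j >])%:R.

(** The coefficients are discrete, so a neighbourhood in the product topology
    only restricts finitely many coordinates. *)
Lemma lc_nbhsP x (U : set (lc k I)) : nbhs x U ->
  exists s : seq I, forall y : lc k I, {in s, forall i, y i = x i} -> U y.
Proof.
(* The filter F of the sets containing all functions that agree with x on some
   finite set converges to x, as it does so in each coordinate. *)
pose B (s : seq I) : set (lc k I) := [set y | {in s, forall i, y i = x i}].
pose F := filter_from setT B.
have FF : Filter F.
  apply: filter_from_filter; first by exists [::].
  move=> s t _ _; exists (s ++ t) => // y yst; split=> i ii; apply: yst;
    by rewrite mem_cat ii ?orbT.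
suff Fx : F --> x by move=> /Fx[s _ sU]; exists s.
apply/cvg_sup => i U' [V] [[A] oA <-] Ax AU'.
exists [:: i] => // y yx; apply: AU'; rewrite /= in Ax *.
by rewrite yx // mem_head.
Qed.

Lemma invariant_subspace r : lc_subspace (invariant r).
Proof.
split=> [x clx i j rij | i j _ // | a x y xr yr i j rij].
- have [y [yr [yi yj]]] :=
    clx _ (filterI (nbhs_coord x i) (nbhs_coord x j)).
  by rewrite -yi -yj; exact: yr.
- by rewrite [LHS](_ : _ = a * x i + y i) // (xr _ _ rij) (yr _ _ rij).
Qed.

Lemma class_ind_invariant r i : Equivalence r -> invariant r (class_ind r i).
Proof.
move=> [_ rS rT] j l rjl; congr (_%:R); congr nat_of_bool.
apply/asbool_equiv_eq; split=> rij; first exact: rT rjl.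
exact: rT (rS _ _ rjl).
Qed.

Lemma class_ind_eq r i j : Equivalence r ->
  class_ind r i i = class_ind r i j -> r i j.
Proof.
move=> [rR _ _]; rewrite /class_ind asboolT; last exact: rR.
by case: asboolP => // _ /eqP; rewrite oner_eq0.
Qed.

(** An invariant function can be matched on finitely many points one after the
    other: a multiple of the class indicator of the next point [i] corrects the
    value at [i].  Requiring the approximation to be invariant as well ensures
    that the values already matched survive: at a point of the class of [i] the
    approximation is then already right at [i], so the multiple is 0. *)
Lemma invariant_interp r (H : set (lc k I)) x (s : seq I) : Equivalence r ->
  lc_subspace H -> (forall i, H (class_ind r i)) -> invariant r x ->
  exists y, [/\ H y, invariant r y & {in s, forall i, y i = x i}].
Proof.
move=> rE [_ H0 Hlin] Hind xr.
have [_ inv0 invlin] := invariant_subspace r.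
elim: s => [|i s [y [Hy yr ys]]]; first by exists 0.
exists ((x i - y i) *: class_ind r i + y); split; first exact: Hlin.
  by apply: invlin => //; exact: class_ind_invariant.
move=> j; rewrite [LHS](_ : _ = (x i - y i) * class_ind r i j + y j) //.
rewrite inE => js; rewrite /class_ind; case: asboolP => [rij|nrij].
  by rewrite mulr1 (yr _ _ rij) subrK; exact: xr.
case/orP: js => [/eqP ji|/ys ->]; last by rewrite mulr0 add0r.
by case: nrij; rewrite ji; case: rE.
Qed.

(** The class indicators are dense in the invariant functions, which form a
    closed subspace. *)
Lemma lc_span_invariant r (B : set (lc k I)) : Equivalence r ->
  B `<=` invariant r -> (forall i, B (class_ind r i)) ->
  lc_span B = invariant r.
Proof.
move=> rE Br Bind; apply/seteqP; split=> [x Bx | x xr H [sH BH]].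
  by apply: Bx; split=> //; exact: invariant_subspace.
have [clH _ _] := sH; apply: clH => U /lc_nbhsP[s sU].
have [y [Hy _ ys]] := invariant_interp s rE sH (fun i => BH _ (Bind i)) xr.
by exists y; split=> //; exact: sU.
Qed.

End InvariantFunctions.

Arguments invariant k {I} r _.
Arguments class_ind k {I} r i _.

(** * Tensor products of spaces of invariant functions *)

Section Tensor.
Variables (k : fieldType) (I J : choiceType).

Definition prod_rel (r : I -> I -> Prop) (r' : J -> J -> Prop)
  (p q : I * J) : Prop := r p.1 q.1 /\ r' p.2 q.2.

Lemma prod_rel_equiv r r' : Equivalence r -> Equivalence r' ->
  Equivalence (prod_rel r r').
Proof.
move=> [rR rS rT] [rR' rS' rT']; split=> [p|p q [pq pq']|p q s [pq pq'] [qs qs']].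
- by split; [exact: rR | exact: rR'].
- by split; [exact: rS _ _ pq | exact: rS' _ _ pq'].
- by split; [exact: rT _ _ _ pq qs | exact: rT' _ _ _ pq' qs'].
Qed.

(** The tensor of two class indicators is the indicator of the product class, so
    the density of indicators applies to the product relation. *)
Lemma lc_tensor_sub_invariant r r' : Equivalence r -> Equivalence r' ->
  lc_tensor_sub (invariant k r) (invariant k r') = invariant k (prod_rel r r').
Proof.
move=> rE rE'; apply: lc_span_invariant; first exact: prod_rel_equiv.
  move=> _ [x xr [y yr <-]] p q [pq1 pq2].
  by rewrite /lc_tensor (xr _ _ pq1) (yr _ _ pq2).
move=> p; exists (class_ind k r p.1); first exact: class_ind_invariant.
exists (class_ind k r' p.2); first exact: class_ind_invariant.
apply/funext => q; rewrite /lc_tensor /class_ind asbool_and.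
by case: asboolP => _; rewrite ?mul1r ?mul0r.
Qed.

End Tensor.

(** * Pullbacks along partial functions *)

(** The relation [G] is the graph of a partial function from [J] to [I], and the
    continuous linear map with matrix [G] is the pullback along it, extended by
    0. *)
Section PartialPullback.
Variables (k : fieldType) (I J : choiceType).
Variables (b : I -> lc k J) (sb : summable b) (G : J -> I -> bool).
Hypothesis bE : forall i j, b i j = (G j i)%:R.
Hypothesis Gfun : forall j i i', G j i -> G j i' -> i = i'.

Lemma lc_ext_pullback x j i : G j i -> lc_ext sb x j = x i.
Proof.
move=> Gji; rewrite -[RHS]mulr1 -(_ : b i j = 1); last by rewrite bE Gji.
rewrite /= lc_ext_funE // (bigD1_seq i) ?fset_uniq //=; last first.
  by rewrite in_fset_set ?inE /= ?bE ?Gji ?oner_eq0 //; exact: sb.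
rewrite big1 ?addr0 // => i' i'i; rewrite bE; case: (boolP (G j i')) => [Gji'|].
  by rewrite (Gfun Gji Gji') eqxx in i'i.
by rewrite mulr0.
Qed.

Lemma lc_ext_pullback0 x j : (forall i, ~~ G j i) -> lc_ext sb x j = 0.
Proof.
move=> Gj; rewrite /= lc_ext_funE // big1 // => i _.
by rewrite bE (negPf (Gj i)) mulr0.
Qed.

(** By symmetry of [r'], the compatibility of [G] with the relations also makes
    its domain of definition a union of classes, on the complement of which the
    pullback vanishes. *)
Lemma pullback_invariant (r : I -> I -> Prop) (r' : J -> J -> Prop) x :
  Equivalence r' ->
  (forall j j' i, r' j j' -> G j i -> exists2 i', G j' i' & r i i') ->
  invariant k r x -> invariant k r' (lc_ext sb x).
Proof.
move=> [_ rS _] Gr xr j j' rjj'.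
have [[i Gji]|nG] := pselect (exists i, G j i).
  have [i' Gji' rii'] := Gr _ _ _ rjj' Gji.
  by rewrite (lc_ext_pullback _ Gji) (lc_ext_pullback _ Gji'); exact: xr.
rewrite !lc_ext_pullback0 // => i; apply/negP => Gi; apply: nG.
  by have [i' Gji' _] := Gr _ _ _ (rS _ _ rjj') Gi; exists i'.
by exists i.
Qed.

End PartialPullback.


(** * Bijections *)

Section Bijections.

Lemma mkbijE (S T : finType) (f : S -> T) (bf : bijective f) :
  bij_fun (mkbij bf) =1 f.
Proof. by move=> x; rewrite /bij_fun /= ffunE. Qed.

Lemma bij_ext (S T : finType) (l l' : bij S T) :
  bij_fun l =1 bij_fun l' -> l = l'.
Proof. by move=> ll'; apply: val_inj; apply/ffunP. Qed.

Lemma bij_fun_inj (S T : finType) (s : bij S T) : injective (bij_fun s).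
Proof. by apply: bij_inj; exact/asboolP/(valP s). Qed.

Lemma bij_act_inj (S T : finType) (s : bij S T) : injective (bij_act s).
Proof.
move=> l l' ll'; apply: bij_ext => i; apply: (@bij_fun_inj _ _ s).
rewrite -(cast_ordKV (card_bij s) i).
by rewrite -!(mkbijE (bij_act_subproof s _)) -/(bij_act s l) -/(bij_act s l') ll'.
Qed.

Lemma oplus_inj (S T : finType) (l l' : bij 'I_#|S| S) (m m' : bij 'I_#|T| T) :
  oplus l m = oplus l' m' -> l = l' /\ m = m'.
Proof.
move=> eqlm.
have eq_fun a : oplus_fun l m a = oplus_fun l' m' a.
  by rewrite -!(mkbijE (oplus_subproof _ _)) -/(oplus l m) eqlm.
split; apply: bij_ext => i.
  have := eq_fun (cast_ord (esym (card_sum S T)) (fintype.unsplit (inl i))).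
  by rewrite /oplus_fun cast_ordKV unsplitK => -[].
have := eq_fun (cast_ord (esym (card_sum S T)) (fintype.unsplit (inr i))).
by rewrite /oplus_fun cast_ordKV unsplitK => -[].
Qed.

End Bijections.

(** * The structure maps of W as pullbacks *)

Section Structure.
Variable k : fieldType.

Definition W_mk (S : finType) (l : bij 'I_#|S| S) (w : word)
  (wS : (wmax w <= #|S|)%N) : W_pb S := (l, exist _ w wS).

Definition W_act_rel (S T : finType) (s : bij S T) (q : W_pb T) (p : W_pb S) : bool :=
  (val q.2 == val p.2) && (q.1 == bij_act s p.1).

Lemma W_act_relE S T (s : bij S T) p q : W_act_gen k s p q = (W_act_rel s q p)%:R.
Proof. by []. Qed.

Lemma W_act_rel_fun S T (s : bij S T) q p p' :
  W_act_rel s q p -> W_act_rel s q p' -> p = p'.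
Proof.
case: p p' => [l w] [l' w'] /andP[/eqP qw /eqP ql] /andP[/eqP qw' /eqP ql'].
congr pair; first by apply: (@bij_act_inj _ _ s); rewrite -ql.
by apply: val_inj; rewrite -qw.
Qed.

Definition W_coprod_rel (S : finType) (q : W_pb S * W_pb S) (p : W_pb S) : bool :=
  [&& val p.2 == wcat (val q.1.2) (val q.2.2), q.1.1 == p.1 & q.2.1 == p.1].

(** A word is a concatenation of given words in one way only, so exactly one
    term of the coproduct contributes. *)
Lemma W_coprod_relE S (p : W_pb S) q : W_coprod_gen k p q = (W_coprod_rel q p)%:R.
Proof.
rewrite /W_coprod_gen fct_sumE /lc_tensor /W_gen.
rewrite (_ : W_coprod_rel q p = [&& W_word p == W_word q.1 ++ W_word q.2,
  q.1.1 == p.1 & q.2.1 == p.1]) //.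
have [wE|wN] := eqVneq (W_word p) (W_word q.1 ++ W_word q.2); last first.
  rewrite big1 // => i _; rewrite -natrM mulnb.
  case: (W_word q.1 =P _) => // q1; case: (W_word q.2 =P _); rewrite ?andbF // => q2.
  by rewrite q1 q2 cat_take_drop eqxx in wN.
have i0P : (size (W_word q.1) < (size (W_word p)).+1)%N.
  by rewrite wE size_cat ltnS leq_addr.
rewrite (bigD1 (Ordinal i0P)) //= big1 => [|i ii0].
  by rewrite addr0 wE take_size_cat // drop_size_cat // !eqxx -natrM mulnb.
case: (W_word q.1 =P _) => [q1|_]; last by rewrite mul0r.
case/eqP: ii0; apply: val_inj => /=.
by rewrite [in RHS]q1 size_takel // -ltnS.
Qed.

Lemma W_coprod_rel_fun S q (p p' : W_pb S) :
  W_coprod_rel q p -> W_coprod_rel q p' -> p = p'.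
Proof.
case: p p' => [l w] [l' w'] /and3P[/eqP qw /eqP ql _] /and3P[/eqP qw' /eqP ql' _].
congr pair; first by rewrite -[l]ql.
by apply: val_inj; rewrite [val w]qw.
Qed.

Definition W_prod_rel (S T : finType) (r : W_pb (S + T)%type)
    (pq : W_pb S * W_pb T) : bool :=
  [&& val pq.1.2 == wcapdown 0 #|S| (val r.2),
      val pq.2.2 == wcapdown #|S| (#|S| + #|T|) (val r.2)
    & r.1 == oplus pq.1.1 pq.2.1].

Lemma W_prod_relE S T (pq : W_pb S * W_pb T) r :
  W_prod_gen k pq r = (W_prod_rel r pq)%:R.
Proof.
have rn : (wmax (val r.2) <= #|S| + #|T|)%N by rewrite -card_sum (valP r.2).
have wS : all (fun a => a <= #|S|)%N (W_word pq.1).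
  by apply/allP/wmax_leP; exact: (valP pq.1.2).
have wT : all (predC (fun a => a <= #|S|)%N) [seq (a + #|S|)%N | a <- W_word pq.2].
  apply/allP => _ /mapP[a /letters_gt0 a0 ->] /=.
  by rewrite -ltnNge -[X in (X < _)%N]add0n ltn_add2r.
rewrite /W_prod_gen /W_prod_rel; case: (r.1 =P _) => _; last first.
  by rewrite !andbF big1 // => A _; rewrite andbF.
under eq_bigr do rewrite andbT.
rewrite (sum_shuffle k _ wS wT) -letters_wcapdown0 -(wcapdown_up rn) andbT.
by rewrite (inj_eq (inj_map (@addIn _))).
Qed.

Lemma W_prod_rel_fun S T r (pq pq' : W_pb S * W_pb T) :
  W_prod_rel r pq -> W_prod_rel r pq' -> pq = pq'.
Proof.
case: pq pq' => [[l v] [m w]] [[l' v'] [m' w']].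
case/and3P => /eqP /= vE /eqP wE /eqP rE.
case/and3P => /eqP /= v'E /eqP w'E /eqP r'E.
have [-> ->] : l = l' /\ m = m' by apply: oplus_inj; rewrite -rE.
congr ((_, _), (_, _)); apply: val_inj; first by rewrite [LHS]vE.
by rewrite [LHS]wE.
Qed.

End Structure.

(** * The subspecies K *)

Section SpeciesK.
Variables (k : fieldType) (R : word -> word -> Prop).
Hypothesis hR : word_relation R.

Definition W_rel (S : finType) (p q : W_pb S) : Prop :=
  p.1 = q.1 /\ R (val p.2) (val q.2).

Lemma W_rel_equiv S : Equivalence (@W_rel S).
Proof.
have [[rR rS rT] _] := hR; split=> [p|p q [pq1 pq2]|p q s [pq1 pq2] [qs1 qs2]].
- by split=> //; exact: rR.
- by split=> //; exact: rS.
- by split; [rewrite pq1 | exact: rT qs2].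
Qed.

Lemma kappaE (S : finType) (E : set word) (l : bij 'I_#|S| S) (p : W_pb S) :
  kappa k E l p = (`[< E (val p.2) >] && (p.1 == l))%:R.
Proof.
rewrite /kappa /lc_sum /W_gen; case: asboolP => [Ep|nEp] /=; last first.
  rewrite fsbig1 // => w Ew; case: eqP => // pw.
  by case: nEp; rewrite (_ : val p.2 = w) //; exact: val_inj.
rewrite -(@fsbig_widen _ _ _ _ [set val p.2]); last 2 first.
- by move=> _ ->.
- move=> w [_ /= pw] /=; case: eqP => // wp; case: pw.
  by apply: val_inj; rewrite -[LHS]wp.
by rewrite fsbig_set1 eqxx.
Qed.

Lemma kappa_class_ind S (p : W_pb S) :
  kappa k [set w | R (val p.2) w] p.1 = class_ind k (@W_rel S) p.
Proof.
apply/funext => q; rewrite kappaE /class_ind andbC asbool_and; congr (_ && _)%:R.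
by rewrite eq_sym; apply/eqP/asboolP.
Qed.

(** By [kappa_class_ind], the spanning elements of K are the class indicators of
    [W_rel]. *)
Lemma K_invariant S : K k R S = invariant k (@W_rel S).
Proof.
apply: lc_span_invariant; first exact: W_rel_equiv.
  move=> x [E [v vS ->] [l ->]].
  rewrite (kappa_class_ind (W_mk l vS)).
  exact: class_ind_invariant (W_rel_equiv S).
move=> p; exists [set w | R (val p.2) w]; last first.
  by exists p.1; rewrite kappa_class_ind.
by exists (val p.2) => //; exact: (valP p.2).
Qed.

Lemma K_tensor S T : lc_tensor_sub (K k R S) (K k R T) =
  invariant k (prod_rel (@W_rel S) (@W_rel T)).
Proof. by rewrite !K_invariant; apply: lc_tensor_sub_invariant; exact: W_rel_equiv. Qed.

Lemma K_subspecies : @subspecies k (W k) (K k R).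
Proof.
split=> [S|S T s _ [x Kx <-]].
  by rewrite K_invariant; exact: invariant_subspace.
move: Kx; rewrite !K_invariant.
apply: (pullback_invariant _ (W_act_relE k s) (@W_act_rel_fun _ _ s)).
  exact: W_rel_equiv.
move=> q q' p [q1 q2] /andP[/eqP qp /eqP qs].
have q'S : (wmax (val q'.2) <= #|S|)%N by rewrite -(card_bij s) (valP q'.2).
exists (W_mk p.1 q'S); first by rewrite /W_act_rel /= eqxx -q1 qs eqxx.
by split=> //=; rewrite -qp.
Qed.

(** The empty word is the only word over the empty alphabet, so that K[∅] is all
    of W[∅]. *)
Lemma K_unit : K k R void (cb_unit (W k) (cst 1)).
Proof.
rewrite K_invariant => -[l w] [l' w'] [/= -> _].
have nil (u : word_le #|{: void}|) : letters (val u) = [::].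
  case: (letters _) (@letters_gt0 (val u)) (elimT (wmax_leP _ _) (valP u)) => //.
  move=> a s /(_ a (mem_head _ _)) a0 /(_ a (mem_head _ _)).
  by rewrite card_void leqNgt a0.
suff -> : w = w' by [].
by do 2 apply: val_inj; rewrite -!/(letters _) !nil.
Qed.

(** The coproduct is the pullback along concatenation.  For necessity, any two
    words are words over a large enough alphabet {1, ..., n}; testing the
    coproduct of the indicator of the class of [vw] at the pairs (v, w) and
    (v', w') shows that vw and v'w' are equivalent. *)
Lemma K_coprod_stable :
  (forall S, cb_coprod (W k) S @` K k R S `<=` lc_tensor_sub (K k R S) (K k R S))
  <-> (forall v v' w w', R v v' -> R w w' -> R (wcat v w) (wcat v' w')).
Proof.
split=> [KD v v' w w' vv' ww'|catR S _ [x Kx <-]].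
  pose n := maxn (wmax v) (wmax w).
  have vn : (wmax v <= #|'I_n|)%N by rewrite card_ord leq_maxl.
  have wn : (wmax w <= #|'I_n|)%N by rewrite card_ord leq_maxr.
  have v'n : (wmax v' <= #|'I_n|)%N by rewrite -(wmax_rel hR vv').
  have w'n : (wmax w' <= #|'I_n|)%N by rewrite -(wmax_rel hR ww').
  pose l := enum_bij 'I_n.
  pose p := W_mk l (wmax_wcat vn wn); pose p' := W_mk l (wmax_wcat v'n w'n).
  pose q := (W_mk l vn, W_mk l wn); pose q' := (W_mk l v'n, W_mk l w'n).
  have Kp : K k R 'I_n (class_ind k (@W_rel _) p).
    by rewrite K_invariant; exact: class_ind_invariant (W_rel_equiv _).
  have qq' : prod_rel (@W_rel _) (@W_rel _) q q' by [].
  have := KD _ _ (imageP _ Kp); rewrite K_tensor => /(_ q q' qq').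
  have eval := lc_ext_pullback (@W_coprod_summable k 'I_n) (@W_coprod_relE k 'I_n)
    (@W_coprod_rel_fun 'I_n).
  rewrite (eval _ q p) ?(eval _ q' p'); try by rewrite /W_coprod_rel /= !eqxx.
  by move=> /(class_ind_eq (W_rel_equiv _))[].
move: Kx; rewrite K_tensor K_invariant.
apply: (pullback_invariant _ (@W_coprod_relE k S) (@W_coprod_rel_fun S)).
  exact: prod_rel_equiv (W_rel_equiv S) (W_rel_equiv S).
move=> q q' p [[q11 q12] [q21 q22]] /and3P[/eqP pq /eqP q1p /eqP q2p].
exists (W_mk p.1 (wmax_wcat (valP q'.1.2) (valP q'.2.2))).
  by rewrite /W_coprod_rel /= -q11 -q21 q1p q2p !eqxx.
by split=> //; rewrite pq; exact: catR.
Qed.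

(** The product is the pullback along cutting a word into its letters at most
    |S| and its other letters.  For necessity, the product of the indicator of
    the class of the two parts of a word is tested at two equivalent words.
    Cutting twice gives all intervals. *)
Lemma K_prod_stable :
  (forall S T, cb_prod (W k) S T @` lc_tensor_sub (K k R S) (K k R T) `<=`
     K k R (S + T)%type)
  <-> (forall v w m n, R v w -> R (wcapdown m n v) (wcapdown m n w)).
Proof.
split=> [KM|capR S T _ [x Kx <-]]; last first.
  move: Kx; rewrite K_tensor K_invariant.
  apply: (pullback_invariant _ (@W_prod_relE k S T) (@W_prod_rel_fun S T)).
    exact: W_rel_equiv.
  move=> r r' pq [r1 r2] /and3P[/eqP pE /eqP qE /eqP rE].
  have p'P : (wmax (wcapdown 0 #|S| (val r'.2)) <= #|S|)%N.
    by rewrite -[leqRHS]subn0 wmax_wcapdown.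
  have q'P : (wmax (wcapdown #|S| (#|S| + #|T|) (val r'.2)) <= #|T|)%N.
    by rewrite -[leqRHS](addKn #|S|) wmax_wcapdown.
  exists (W_mk pq.1.1 p'P, W_mk pq.2.1 q'P).
    by rewrite /W_prod_rel /= -r1 rE !eqxx.
  by split; split=> //=; rewrite ?pE ?qE; exact: capR.
(* One product, over alphabets of sizes m and t, controls both parts of the
   word. *)
have cut (m t : nat) v w : R v w -> (wmax v <= m + t)%N ->
    R (wcapdown 0 m v) (wcapdown 0 m w) /\
    R (wcapdown m (m + t) v) (wcapdown m (m + t) w).
  move=> vw vmt; have wmt : (wmax w <= m + t)%N by rewrite -(wmax_rel hR vw).
  have vS : (wmax v <= #|{: 'I_m + 'I_t}|)%N by rewrite card_sum !card_ord.
  have wS : (wmax w <= #|{: 'I_m + 'I_t}|)%N by rewrite card_sum !card_ord.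
  have bound1 u : (wmax (wcapdown 0 m u) <= #|'I_m|)%N.
    by rewrite card_ord -[leqRHS]subn0 wmax_wcapdown.
  have bound2 u : (wmax (wcapdown m (m + t) u) <= #|'I_t|)%N.
    by rewrite card_ord -[leqRHS](addKn m) wmax_wcapdown.
  pose l := enum_bij 'I_m; pose l' := enum_bij 'I_t.
  pose pq u := (W_mk l (bound1 u), W_mk l' (bound2 u)).
  pose x := class_ind k (prod_rel (@W_rel 'I_m) (@W_rel 'I_t)) (pq v).
  have rE : Equivalence (prod_rel (@W_rel 'I_m) (@W_rel 'I_t)).
    exact: prod_rel_equiv (W_rel_equiv _) (W_rel_equiv _).
  have Kx : lc_tensor_sub (K k R 'I_m) (K k R 'I_t) x.
    by rewrite K_tensor; exact: class_ind_invariant.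
  pose rv := W_mk (oplus l l') vS; pose rw := W_mk (oplus l l') wS.
  have rvw : W_rel rv rw by [].
  have := KM _ _ _ (imageP _ Kx); rewrite K_invariant => /(_ rv rw rvw).
  have eval := lc_ext_pullback (@W_prod_summable k 'I_m 'I_t)
    (@W_prod_relE k 'I_m 'I_t) (@W_prod_rel_fun 'I_m 'I_t).
  rewrite (eval _ rv (pq v)) ?(eval _ rw (pq w));
    try by rewrite /W_prod_rel /= !card_ord !eqxx.
  by move=> /(class_ind_eq rE)[[_ ?] [_ ?]].
(* The size t of the second alphabet only has to be large: m + t must bound both
   n and the letters of v. *)
move=> v w m n vw; pose t := (n + wmax v)%N.
have nt : (n <= m + t)%N by rewrite /t addnCA leq_addr.
have [_ vw'] := cut m t _ _ vw (leq_trans (leq_addl _ _) (leq_addl _ _)).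
rewrite !(wcapdown_wcapdown m _ nt).
by have [] := cut (n - m)%N _ _ _ vw' (leq_addl _ _).
Qed.

End SpeciesK.

Theorem theorem5p5 (k : fieldType) (R : word -> word -> Prop)
    (hR : word_relation R) :
  sub_coalgebroid (W k) (K k R) <-> algebraic R.
Proof.
split=> [[_ KD KM _]|[catR capR]].
  by split; [exact/(K_coprod_stable k hR) | exact/(K_prod_stable k hR)].
split; [exact: K_subspecies | exact/(K_coprod_stable k hR)
  | exact/(K_prod_stable k hR) | exact: K_unit].
Qed.
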